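(* Let $\mathcal{X}$ be a compact subspace of $\mathbb{R}^m$, let $k:\mathcal{X}\times\mathcal{X}\to\mathbb{R}$ be a positive definite kernel that is a continuous function on $\mathcal{X}\times\mathcal{X}$, with reproducing kernel Hilbert space $\mathcal{F}$ and feature map $\Phi:\mathcal{X}\to\mathcal{F}$. Let $p$ be a (Borel) probability distribution on $\mathcal{X}$ and $\mu=\mathbb{E}_{p(x)}\Phi(x)$. Let $\widetilde{\mathcal{F}}$ be the space of directions of the affine hull of $\mathcal{M}$, where $\mathcal{M}$ is the convex hull of $\{\Phi(x):x\in\mathcal{X}\}$. If $\mathcal{F}$ is infinite-dimensional, then there exists no $d>0$ such that $$\forall f\in\widetilde{\mathcal{F}},\qquad \langle\mu,f\rangle+d\,\|f\|\le\max_{x\in\mathcal{X}}f(x).$$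
   Context: Elements $f\in\mathcal{F}$ are identified with real functions on $\mathcal{X}$ by $f(x)=\langle f,\Phi(x)\rangle$, and $k(x,y)=\langle\Phi(x),\Phi(y)\rangle$; ''positive definite'' is in the usual kernel sense (all Gram matrices are positive semidefinite). The norm $\|\cdot\|$ is that of $\mathcal{F}$. The mean element $\mu=\mathbb{E}_{p(x)}\Phi(x)\in\mathcal{F}$ satisfies $\langle\mu,f\rangle=\mathbb{E}_{p(x)}f(x)$ for all $f\in\mathcal{F}$. The space of directions (difference space) of an affine subspace $\mathcal{A}$ is the linear subspace $\{a-b:a,b\in\mathcal{A}\}$; for the affine hull of $\mathcal{M}$ this is the linear span of $\{\Phi(x)-\Phi(y):x,y\in\mathcal{X}\}$. *)

(* Defs.v *)
From HB Require Import structures.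
From mathcomp Require Import all_boot all_order all_algebra.
From mathcomp Require Import all_classical all_reals all_analysis.
From mathcomp Require Import ring lra.

Set Implicit Arguments.
Unset Strict Implicit.
Unset Printing Implicit Defensive.

Import Order.TTheory GRing.Theory Num.Theory.
Import numFieldNormedType.Exports.

Local Open Scope classical_set_scope.
Local Open Scope ring_scope.

(* R^m with its Borel sigma-algebra. *)
Notation borel_rV R m := (g_sigma_algebraType (@open 'rV[R]_m)).

(* Only the values of k on X `*` X matter. *)
Definition posdef_kernel (R : realType) (T : Type) (X : set T)
    (k : T -> T -> R) : Prop :=
  forall (n : nat) (x : 'I_n -> T), (forall i, X (x i)) ->
    let G := \matrix_(i < n, j < n) k (x i) (x j) in
    G^T = G /\ forall c : 'cV[R]_n, 0 <= (c^T *m G *m c) 0 0.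

(* F is complete by its type, so this makes (F, ip) a real Hilbert space. *)
Definition hilbert_norm (R : realType) (F : completeNormedModType R)
    (ip : {dot F for idfun}) : Prop :=
  forall f : F, `|f| = Num.sqrt (ip f f).

(* (F, ip) is the reproducing kernel Hilbert space of k on X, with feature map
   Phi (only its values on X matter): f in F is the function
   x |-> ip f (Phi x) on X, and the second clause says that this identification
   of the elements of F with functions on X is injective.  In particular Phi x
   is the function k(x, _), and the functions Phi x span a dense subspace. *)
Definition is_RKHS (R : realType) (T : Type) (X : set T) (k : T -> T -> R)
    (F : completeNormedModType R) (ip : {dot F for idfun}) (Phi : T -> F)
    : Prop :=
  [/\ hilbert_norm ip,
      forall f g : F, (forall x, X x -> ip f (Phi x) = ip g (Phi x)) -> f = g &
      forall x y, X x -> X y -> k x y = ip (Phi x) (Phi y)].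

(* mu = E_p Phi in the weak sense; mu is unique, ip being definite. *)
Definition is_mean_element d (T : measurableType d) (R : realType)
    (p : probability T R) (X : set T) (F : completeNormedModType R)
    (ip : {dot F for idfun}) (Phi : T -> F) (mu : F) : Prop :=
  forall f : F, ((ip mu f)%:E = \int[p]_(x in X) (ip f (Phi x))%:E)%E.

Definition infinite_dimensional (R : realType) (V : lmodType R) : Prop :=
  ~ exists (n : nat) (e : 'I_n -> V),
      forall v : V, exists c : 'I_n -> R, v = \sum_(i < n) c i *: e i.

Definition convex_hull (R : realType) (V : lmodType R) (A : set V) : set V :=
  smallest (@convex_set R V) A.

Definition affine_set (R : realType) (V : lmodType R) (A : set V) : Prop :=
  forall (x y : V) (t : R), A x -> A y -> A (t *: x + (1 - t) *: y).

Definition affine_hull (R : realType) (V : lmodType R) (A : set V) : set V :=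
  smallest (@affine_set R V) A.

Definition directions (V : zmodType) (A : set V) : set V :=
  [set v | exists a b, [/\ A a, A b & v = a - b]].

(* A function of the RKHS of a continuous kernel on a compact set attains its
   maximum; `sup` over X thus faithfully renders "max". *)
Section rkhs_max.
Context {R : realType} {T : topologicalType} {F : completeNormedModType R}.
Variables (ip : {dot F for idfun}) (X : set T) (k : T -> T -> R).
Variable Phi : T -> F.
Hypothesis rkhs : is_RKHS X k ip Phi.
Hypothesis ck : {within X `*` X, continuous (fun z : T * T => k z.1 z.2)}.

Lemma dot_cauchy_schwarz (u v : F) : ip u v ^+ 2 <= ip u u * ip v v.
Proof.
have dC (a b : F) : ip a b = ip b a.
  by rewrite (hermitian_subproof (s := ip)) expr0 mul1r.
have dD (a b c : F) : ip (a + b) c = ip a c + ip b c by rewrite linearDl.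
have dZ t (a c : F) : ip (t *: a) c = t * ip a c by rewrite linearZl_LR.
have [->|v0] := eqVneq v 0; first by rewrite !linear0r expr0n.
have vv := neq0_dnorm_gt0 (s := ip) v v0.
have : 0 <= ip (u + (- (ip u v / ip v v)) *: v) (u + (- (ip u v / ip v v)) *: v).
  set w := u + _; have [->|w0] := eqVneq w 0; first by rewrite linear0r.
  exact/ltW/(neq0_dnorm_gt0 (s := ip)).
rewrite dD dZ dC dD dZ [ip v (_ + _)]dC dD dZ [ip v u]dC.
move=> H; rewrite -subr_ge0; have := mulr_ge0 (ltW vv) H.
congr (0 <= _); field; exact: lt0r_neq0.
Qed.

Lemma rkhs_continuous (f : F) : {within X, continuous (fun x => ip f (Phi x))}.
Proof.
have [_ _ kE] := rkhs.
apply/subspace_continuousP => x Xx.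
pose D (y : T) := k y y - 2 * k x y + k x x.
have DE y : X y -> D y = ip (Phi y - Phi x) (Phi y - Phi x).
  move=> Xy; rewrite /D !kE// linearBl !linearBr/=.
  rewrite [ip (Phi y) (Phi x)](hermitian_subproof (s := ip)) expr0 mul1r /=; ring.
have cD : D y @[y --> within X (nbhs x)] --> (0 : R).
  have -> : 0 = k x x - 2 * k x x + k x x by ring.
  move/subspace_continuousP : ck => /(_ (x, x) (conj Xx Xx)) /= cxx.
  have cW (g : T -> T * T) : {for x, continuous g} -> g x = (x, x) ->
      (forall y, X y -> (X `*` X) (g y)) ->
      k (g y).1 (g y).2 @[y --> within X (nbhs x)] --> k x x.
    move=> cg gx Xg; apply: (@cvg_comp _ _ _ g (fun z => k z.1 z.2) _
      (within (X `*` X) (nbhs (x, x))) _ _ cxx).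
    move=> A /= WA; rewrite /within/=.
    have : nbhs (g x) (fun z => (X `*` X) z -> A z) by rewrite gx.
    move/cg; rewrite /nbhs/=; apply: filterS => y /= gA Xy.
    by apply: gA; exact: Xg.
  apply: cvgD; last exact: cvg_cst.
  apply: cvgB; last apply: cvgM; first 1 last.
  - exact: cvg_cst.
  - apply: (cW (fun y => (x, y))) => //.
    by apply: cvg_pair => //=; exact: cvg_cst.
  - apply: (cW (fun y => (y, y))) => //.
    by apply: cvg_pair => //=; exact: cvg_id.
apply/cvgrPdist_le => e e0.
have e1 : 0 < e ^+ 2 / (ip f f + 1).
  rewrite divr_gt0 ?exprn_gt0// ltr_wpDl//.
  have [->|f0] := eqVneq f 0; first by rewrite linear0r.
  exact/ltW/(neq0_dnorm_gt0 (s := ip)).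
move/cvgrPdist_le : cD => /(_ _ e1); rewrite !near_withinE.
apply: filterS => y /= Dy Xy; have {Dy} := Dy Xy.
have ff : 0 <= ip f f.
  have [->|f0] := eqVneq f 0; first by rewrite linear0r.
  exact/ltW/(neq0_dnorm_gt0 (s := ip)).
rewrite sub0r normrN DE// -(distrC (ip f (Phi y))) -linearBr/= => Dy.
rewrite -(@ler_pXn2r _ 2) ?nnegrE//; last exact: ltW.
rewrite real_normK ?num_real//.
apply: (le_trans (dot_cauchy_schwarz _ _)).
apply: (le_trans (ler_wpM2l ff (le_trans (ler_norm _) Dy))).
by rewrite mulrCA ler_piMr ?exprn_ge0 ?ltW// ltr_pdivrMr; lra.
Qed.

Lemma rkhs_sup_max (f : F) : X !=set0 -> compact X ->
  exists x, [/\ X x, forall y, X y -> ip f (Phi y) <= ip f (Phi x) &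
    sup [set ip f (Phi y) | y in X] = ip f (Phi x)].
Proof.
move=> X0 cX; have [c] := compact_EVT_max X0 cX (@rkhs_continuous f).
rewrite inE => Xc cmax; exists c; split=> // [y Xy|].
  by apply: cmax; rewrite inE.
apply/eqP; rewrite eq_le; apply/andP; split.
  apply: ge_sup; first by exists (ip f (Phi c)); exists c.
  by move=> _ [y Xy <-]; apply: cmax; rewrite inE.
apply: ub_le_sup; last by exists c.
by exists (ip f (Phi c)) => _ [y Xy <-]; apply: cmax; rewrite inE.
Qed.

End rkhs_max.

(* Main.v *)
(* [Phi @` X] is compact, hence within d/2 of a finite set [s].  As F is
   infinite-dimensional, so is Ftilde, which therefore contains some f != 0
   orthogonal to [c - mu] for every c in [s].  Then f x - <mu, f> =
   <f, Phi x - c> <= (d/2) |f| for a point c of [s] close to Phi x, so that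
   <mu, f> + d |f| <= max f fails. *)
Require Import Defs.
From HB Require Import structures.
From mathcomp Require Import all_boot all_order all_algebra.
From mathcomp Require Import all_classical all_reals all_analysis.
From mathcomp Require Import ring lra.

Set Implicit Arguments.
Unset Strict Implicit.
Unset Printing Implicit Defensive.

Import Order.TTheory GRing.Theory Num.Theory.
Import numFieldNormedType.Exports.

Local Open Scope classical_set_scope.
Local Open Scope ring_scope.

(** Rank argument: choose a family in [W] whose images under [L] have maximal rank, at most [N].
    Adjoining any [w] of [W] cannot raise the rank, so [L w] is a combination of these images, and
    injectivity of [L] on the subspace [W] lifts the combination to [w]. *)
Lemma linear_injective_finite_span (K : fieldType) (V : lmodType K)
    (W : set V) (N : nat) (L : {linear V -> 'rV[K]_N}) :
  (forall (a : K) u v, W u -> W v -> W (a *: u + v)) -> W 0 ->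
  (forall w, W w -> L w = 0 -> w = 0) ->
  exists (n : nat) (e : 'I_n -> V),
    forall w, W w -> exists c : 'I_n -> K, w = \sum_(i < n) c i *: e i.
Proof.
move=> Wlin W0 Linj.
pose P r := `[< exists (n : nat) (e : 'I_n -> V),
  (forall i, W (e i)) /\ \rank (\matrix_i L (e i)) = r >].
have exP : exists r, P r.
  by eexists; apply/asboolP; exists 0, (fun=> 0); split=> [[]|].
have ubP r : P r -> (r <= N)%N by move=> /asboolP[n [e [_ <-]]]; exact: rank_leq_col.
case: (ex_maxnP exP ubP) => r /asboolP[n [e [We rk]]] rmax.
exists n, e => w Ww.
pose e' (i : 'I_(n + 1)%N) := match fintype.split i with inl j => e j | inr _ => w end.
have e'E : \matrix_i L (e' i) = col_mx (\matrix_i L (e i)) (L w).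
  apply/row_matrixP => i; rewrite rowK /e'; case: split_ordP => j ->.
    by rewrite rowKu rowK.
  by rewrite rowKd ord1 row_id.
have /rmax : P (\rank (col_mx (\matrix_i L (e i)) (L w))).
  apply/asboolP; exists (n + 1)%N, e'; rewrite e'E; split=> // i.
  by rewrite /e'; case: fintype.split.
have sub : (\matrix_i L (e i) <= col_mx (\matrix_i L (e i)) (L w))%MS.
  by rewrite -addsmxE addsmxSl.
(* Equal rank together with [sub] forces equal row spaces; [c] holds the coordinates of [L w]. *)
rewrite -rk (geq_leqif (mxrank_leqif_sup sub)) col_mx_sub => /andP[_ /submxP[c Lw]].
exists (fun i => c 0 i); apply/eqP; rewrite -subr_eq0; apply/eqP; apply: Linj.
  have Wsum : W (\sum_(i < n) c 0 i *: e i).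
    by elim/big_ind : _ => // [u v Wu Wv|i _]; [rewrite -[u]scale1r; exact: Wlin|
      rewrite -[_ *: _]addr0; exact: Wlin].
  by rewrite addrC -scaleN1r; exact: Wlin.
rewrite linearB /= Lw linear_sum /= mulmx_sum_row; apply/eqP; rewrite subr_eq0.
by apply/eqP/eq_bigr => i _; rewrite linearZ /= rowK.
Qed.

Section dot_row.
Variables (R : realType) (F : lmodType R) (ip : {dot F for idfun}).
Variables (n : nat) (e : 'I_n -> F).

(** The kernel of this map is the orthogonal complement of the family [e], so finitely many
    orthogonality conditions become one linear equation. *)
Definition dot_row (f : F) : 'rV[R]_n := \row_i ip f (e i).

Let dot_row_is_linear : linear dot_row.
Proof.
move=> a u v; apply/rowP => i; rewrite !mxE.
by rewrite linearDl linearZl_LR.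
Qed.

HB.instance Definition _ :=
  GRing.isLinear.Build R F 'rV[R]_n _ dot_row dot_row_is_linear.

End dot_row.

(** Total boundedness: the centres of a finite subcover by [eps]-balls form the net. *)
Lemma compact_finite_net (R : realType) (V : normedModType R) (A : set V)
    (eps : R) : compact A -> 0 < eps ->
  exists s : seq V, forall a, A a -> exists2 c, c \in s & `|c - a| < eps.
Proof.
rewrite compact_cover => cA eps0.
have [||D _ cov] := cA V A (fun c => ball c eps).
- by move=> c _; exact: ball_open.
- by move=> a Aa; exists a => //; exact: ballxx.
exists (finmap.enum_fset D) => a /cov[c cD]; rewrite -ball_normE /= => ca.
by exists c.
Qed.

Section feature_map.
Context {R : realType} {T : topologicalType} {F : completeNormedModType R}.
Variables (ip : {dot F for idfun}) (X : set T) (k : T -> T -> R).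
Variable Phi : T -> F.
Hypothesis rkhs : is_RKHS X k ip Phi.

Lemma dotC (u v : F) : ip u v = ip v u.
Proof. by rewrite (hermitian_subproof (s := ip)) expr0 mul1r. Qed.

Lemma dot_ge0 (u : F) : 0 <= ip u u.
Proof.
have [->|u0] := eqVneq u 0; first by rewrite linear0r.
exact/ltW/(neq0_dnorm_gt0 (s := ip)).
Qed.

Lemma dot_normE (u : F) : ip u u = `|u| ^+ 2.
Proof. by have [-> _ _] := rkhs; rewrite sqr_sqrtr// dot_ge0. Qed.

Lemma dot_le_norm (u v : F) : ip u v <= `|u| * `|v|.
Proof.
apply: le_trans (ler_norm _) _.
rewrite -(@ler_pXn2r _ 2) ?nnegrE ?mulr_ge0//.
by rewrite real_normK ?num_real// exprMn -!dot_normE dot_cauchy_schwarz.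
Qed.

(** The squared distance of [Phi x] and [Phi y] expands to [k y y - 2 k x y + k x x], which tends to
    0 as [y] tends to [x]. It makes the image of [X] under [Phi] compact. *)
Lemma feature_continuous :
  {within X `*` X, continuous (fun z : T * T => k z.1 z.2)} ->
  {within X, continuous Phi}.
Proof.
move=> ck; have [_ _ kE] := rkhs; apply/subspace_continuousP => x Xx.
(* Here both arguments move at once, so joint continuity of [k] at [(x, x)] is composed with the
   diagonal map. *)
have cdiag : k y y @[y --> within X (nbhs x)] --> k x x.
  move/subspace_continuousP : ck => /(_ (x, x) (conj Xx Xx)) /= cxx.
  apply: (@cvg_comp _ _ _ (fun y => (y, y)) (fun z => k z.1 z.2) _
    (within (X `*` X) (nbhs (x, x))) _ _ cxx) => A /= WA.
  have : {for x, continuous (fun y : T => (y, y))}.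
    by apply: cvg_pair => //=; exact: cvg_id.
  move=> /(_ _ WA); rewrite /nbhs /=.
  by apply: filterS => y /= yA Xy; exact: yA.
have cx : ip (Phi x) (Phi y) @[y --> within X (nbhs x)] --> ip (Phi x) (Phi x).
  by move/subspace_continuousP : (@rkhs_continuous _ _ _ _ _ _ _ rkhs ck (Phi x)); exact.
have cD : `|Phi x - Phi y| ^+ 2 @[y --> within X (nbhs x)] --> (0 : R).
  have -> : 0 = k x x - 2 * ip (Phi x) (Phi x) + k x x by rewrite kE//; ring.
  have DE y : X y -> `|Phi x - Phi y| ^+ 2 =
      k y y - 2 * ip (Phi x) (Phi y) + k x x.
    move=> Xy; rewrite -dot_normE !kE// linearBl !linearBr /=.
    rewrite (dotC (Phi y) (Phi x)); ring.
  apply: (cvg_trans (G := k y y - 2 * ip (Phi x) (Phi y) + k x x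
      @[y --> within X (nbhs x)])).
    by apply: near_eq_cvg; rewrite near_withinE; apply: nearW => y Xy; rewrite DE.
  apply: cvgD; last exact: cvg_cst.
  by apply: cvgB => //; apply: cvgM => //; exact: cvg_cst.
apply/cvgrPdist_lt => e e0.
move/cvgrPdist_lt : cD => /(_ _ (exprn_gt0 2 e0)); apply: filterS => y.
rewrite sub0r normrN ger0_norm ?exprn_ge0//.
by rewrite ltr_pXn2r ?nnegrE// ltW.
Qed.

(** Passing to differences loses at most one dimension: a vector orthogonal to every [e i] and to
    [Phi x0] is orthogonal to every [Phi x], hence vanishes as a function on [X] and is 0. So
    [dot_row] for the extended family is injective on [F]. *)
Lemma rkhs_finite_span (x0 : T) (n : nat) (e : 'I_n -> F) :
  (forall x, X x -> exists c : 'I_n -> R,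
    Phi x - Phi x0 = \sum_(i < n) c i *: e i) ->
  ~ infinite_dimensional F.
Proof.
move=> span; apply.
pose e' (i : 'I_(n + 1)%N) := match fintype.split i with inl j => e j | inr _ => Phi x0 end.
have [||f _ f0|N [b bE]] := @linear_injective_finite_span _ F setT _ (dot_row ip e').
- by [].
- by [].
- have [_ inj _] := rkhs.
  have orth i : ip f (e' i) = 0 by move/rowP : f0 => /(_ i); rewrite !mxE.
  apply: inj => x /span[c /eqP]; rewrite subr_eq => /eqP ->.
  rewrite linear0l linearDr /= linear_sumr /= big1 ?add0r => [|i _].
    (* The last entry of [e'] is [Phi x0]; the first [n] are the [e i]. *)
    have := orth (rshift n 0).
    by rewrite /e'; case: split_ordP => j // /eqP; rewrite ?eq_lrshift ?eq_rlshift.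
  rewrite linearZr_LR /=; have := orth (lshift 1 i).
  rewrite /e'; case: split_ordP => j; last by move/eqP; rewrite ?eq_lrshift ?eq_rlshift.
  by move=> /lshift_inj <- ->; rewrite mulr0.
by exists N, b => v; exact: bE.
Qed.

End feature_map.

Lemma affine_hull_affine (R : realType) (V : lmodType R) (A : set V) :
  affine_set (affine_hull A).
Proof.
move=> x y t Ax Ay B AB; have [affB _] := AB.
by apply: affB; [exact: Ax B AB|exact: Ay B AB].
Qed.

Lemma directions_linear (R : realType) (V : lmodType R) (A : set V) :
  affine_set A ->
  forall (t : R) u v, directions A u -> directions A v -> directions A (t *: u + v).
Proof.
move=> affA t _ _ [a [b [Aa Ab ->]]] [a' [b' [Aa' Ab' ->]]].
(* [c = t a + (1 - t) b], and [c + a' - b] is twice the midpoint of [c, a']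
   minus [b]. *)
pose c := t *: a + (1 - t) *: b.
pose h := 2^-1 *: c + (1 - 2^-1) *: a'.
have Ac : A c by exact: affA.
have Ah : A h by exact: affA.
have h2 : 2 *: h = c + a'.
  rewrite /h scalerDr !scalerA mulfV ?pnatr_eq0// scale1r.
  have -> : 2 * (1 - 2^-1) = 1 :> R by lra.
  by rewrite scale1r.
(* As [c - b] is [t] times the first direction, the sum sought is [(c + a' - b) - b']. *)
exists (2 *: h + (1 - 2) *: b), b'; split => //; first exact: affA.
have -> : 1 - 2 = -1 :> R by lra.
rewrite h2 scaleN1r /c scalerBl scale1r scalerBr.
rewrite !addrA; congr (_ - _); rewrite (addrAC _ a'); congr (_ + _).
by rewrite (addrAC _ (- (t *: b))) addrK.
Qed.

Theorem proposition2 (R : realType) (m : nat) (X : set 'rV[R]_m)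
    (cptX : compact X)
    (k : 'rV[R]_m -> 'rV[R]_m -> R)
    (k_posdef : posdef_kernel X k)
    (k_cont : {within X `*` X,
                 continuous (fun z : 'rV[R]_m * 'rV[R]_m => k z.1 z.2)})
    (F : completeNormedModType R) (ip : {dot F for idfun})
    (Phi : 'rV[R]_m -> F) (rkhsF : is_RKHS X k ip Phi)
    (p : probability (borel_rV R m) R) (pX : p X = 1%:E)
    (mu : F) (mu_mean : is_mean_element p X ip Phi mu)
    (infF : infinite_dimensional F) :
  let M := convex_hull [set Phi x | x in X] in
  let Ftilde := directions (affine_hull M) in
  ~ exists d : R, 0 < d /\
      forall f : F, Ftilde f ->
        ip mu f + d * `|f| <= sup [set ip f (Phi x) | x in X].
Proof.
move=> M Ftilde [d [d0 H]].
have [x0 Xx0] : X !=set0.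
  apply/set0P/eqP => X0; move: pX; rewrite X0 measure0 => /eqP.
  by rewrite eq_sym onee_eq0.
have hullPhi x : X x -> affine_hull M (Phi x).
  by move=> Xx; apply: sub_gen_smallest; apply: sub_gen_smallest; exists x.
have Flin := directions_linear (@affine_hull_affine _ _ M).
have d20 : 0 < d / 2 by rewrite divr_gt0.
have [s sP] := compact_finite_net
  (continuous_compact (feature_continuous rkhsF k_cont) cptX) d20.
pose e (i : 'I_(size s)) := tnth (in_tuple s) i - mu.
have [f [Ff f0 forth]] : exists f, [/\ Ftilde f, f != 0 & dot_row ip e f = 0].
  (* Otherwise [dot_row ip e] is injective on [Ftilde], so finitely many vectors span [Ftilde], in
     particular all [Phi x - Phi x0], and [F] is finite-dimensional. *)
  apply: contrapT => nof.
  have [||w Fw w0|n [b bE]] := @linear_injective_finite_span _ _ Ftilde _ (dot_row ip e).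
  - exact: Flin.
  - by exists (Phi x0), (Phi x0); rewrite subrr; split=> //; exact: hullPhi.
  - by apply: contrapT => /eqP wn0; apply: nof; exists w.
  apply: (rkhs_finite_span rkhsF (x0 := x0) (e := b)) infF => x Xx.
  by apply: bE; exists (Phi x), (Phi x0); split=> //; exact: hullPhi.
have [x [Xx _ fmax]] := rkhs_sup_max rkhsF k_cont f (ex_intro _ x0 Xx0) cptX.
have := H f Ff; rewrite fmax leNgt => /negP; apply.
have [|c cs cx] := sP (Phi x); first by exists x.
have fc : ip f c = ip f mu.
  move: cs => /(tnthP (in_tuple s))[i ->]; apply/eqP.
  rewrite -subr_eq0 -linearBr /=.
  by move/rowP : forth => /(_ i); rewrite !mxE => ->.
(* With [ip f mu] replaced by [ip f c], what remains is [ip f (Phi x - c) < d * |f|]: Cauchy-Schwarz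
   and the net radius [d / 2] give it, strictly because [f] is nonzero. *)
rewrite (dotC ip mu) -fc -ltrBlDl -linearBr /=.
apply: (le_lt_trans (dot_le_norm rkhsF _ _)).
rewrite mulrC distrC ltr_pM2r ?normr_gt0//; apply: lt_trans cx _; lra.
Qed.
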